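(* There exists a left invariant weak Riemannian metric $\sigma$ on the infinite dimensional Heisenberg group $\mathbb{H}$ whose associated geodesic distance $d$ is not positive on all couples of distinct points; that is, there exist $p,q\in\mathbb{H}$ with $p\neq q$ and $d(p,q)=0$.
   Context: $\ell^2$ is the Hilbert space of real square-summable sequences with its standard scalar product $\langle\cdot,\cdot\rangle$. The infinite dimensional Heisenberg group $\mathbb{H}$ is the Hilbert space $\ell^2\times\ell^2\times\mathbb{R}$ (a Hilbert manifold, with each tangent space $T_p\mathbb{H}$ canonically identified with $\ell^2\times\ell^2\times\mathbb{R}$) equipped with the Lie group operation $$(h_1,h_2,\tau)(h_1',h_2',\tau')=(h_1+h_1',\,h_2+h_2',\,\tau+\tau'+\langle h_1,h_2'\rangle-\langle h_2,h_1'\rangle).$$ The identity is $0$ and the inverse of $p$ is $-p$. For $p=(p_1,p_2,p_3)\in\mathbb{H}$, let $L_p$ be the left multiplication $L_p(r)=pr$; its differential at any point is $(dL_p)(v_1,v_2,v_3)=(v_1,v_2,v_3+\langle p_1,v_2\rangle-\langle p_2,v_1\rangle)$. A left invariant weak Riemannian metric $\sigma$ on $\mathbb{H}$ is determined by a scalar product (symmetric, positive definite bilinear form) $\sigma_0:T_0\mathbb{H}\times T_0\mathbb{H}\to\mathbb{R}$ that is continuous with respect to the Hilbert space topology (it is not required to induce that topology), by setting $\sigma_p(v,w)=\sigma_0\big((dL_{-p})_pv,(dL_{-p})_pw\big)$ for $p\in\mathbb{H}$ and $v,w\in T_p\mathbb{H}$. The length of a (continuous and) piecewise smooth curve $\gamma:[0,1]\to\mathbb{H}$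 is $\ell_\sigma(\gamma)=\int_0^1\sqrt{\sigma_{\gamma(t)}(\dot\gamma(t),\dot\gamma(t))}\,dt$, and the associated geodesic distance is $$d(p,q)=\inf\{\ell_\sigma(\gamma):\gamma:[0,1]\to\mathbb{H}\text{ piecewise smooth},\ \gamma(0)=p,\ \gamma(1)=q\}.$$ *)

(* Defs.v *)
From HB Require Import structures.
From mathcomp Require Import all_boot all_order all_algebra.
From mathcomp Require Import sesquilinear ring lra.
From mathcomp Require Import all_classical all_reals all_analysis.

Set Implicit Arguments.
Unset Strict Implicit.
Unset Printing Implicit Defensive.
Import Order.TTheory GRing.Theory Num.Theory.
Import numFieldNormedType.Exports.

Local Open Scope classical_set_scope.
Local Open Scope ring_scope.

Definition square_summable (R : realType) : {pred nat -> R} :=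
  mem [set u : nat -> R | cvgn (series (fun n => u n ^+ 2))].

Section square_summable.
Variable R : realType.
Implicit Types u v : nat -> R.

Lemma square_summableP u :
  reflect (cvgn (series (fun n => u n ^+ 2))) (u \in @square_summable R).
Proof. exact: asboolP. Qed.

(* |uv| <= u^2 + v^2, hence the series of the scalar product converges. *)
Lemma cvg_series_mul u v : u \in @square_summable R ->
  v \in @square_summable R -> cvgn (series (fun n => u n * v n)).
Proof.
move=> /square_summableP cu /square_summableP cv; apply: normed_cvg.
apply: (@series_le_cvg R _ (fun n => u n ^+ 2 + v n ^+ 2)) => [n|n|n|].
- exact: normr_ge0.
- by rewrite addr_ge0 ?sqr_ge0.
- rewrite /= normrM -(real_normK (num_real (u n))) -(real_normK (num_real (v n))).
  by have := normr_ge0 (u n); have := normr_ge0 (v n); nra.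
- exact: is_cvg_seriesD.
Qed.

Fact square_summable_submod_closed : submod_closed (@square_summable R).
Proof.
split=> [|a u v hu hv]; apply/square_summableP.
  rewrite (_ : series _ = cst 0); first exact: is_cvg_cst.
  by apply/funext => n; rewrite /series /= big1 // => i _; rewrite expr0n.
rewrite (_ : (fun n => _) = (a ^+ 2 *: (fun n => u n ^+ 2) +
    ((a *+ 2) *: (fun n => u n * v n) + (fun n => v n ^+ 2)))); last first.
  apply/funext => n; rewrite !fctE /= /GRing.scale /=; ring.
apply: is_cvg_seriesD; first exact/is_cvg_seriesZ/square_summableP.
by apply: is_cvg_seriesD; [exact/is_cvg_seriesZ/cvg_series_mul
                          |exact/square_summableP].
Qed.

HB.instance Definition _ := GRing.isSubmodClosed.Build R (nat -> R)
  (@square_summable R) square_summable_submod_closed.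

End square_summable.

Record ell2 (R : realType) := Ell2 {
  ell2_val :> nat -> R ;
  _ : ell2_val \in @square_summable R }.

HB.instance Definition _ (R : realType) := [isSub for @ell2_val R].
HB.instance Definition _ (R : realType) := [Choice of ell2 R by <:].
HB.instance Definition _ (R : realType) :=
  [SubChoice_isSubLmodule of ell2 R by <:].

Definition ell2_dot (R : realType) (x y : ell2 R) : R :=
  limn (series (fun n => x n * y n)).

Section ell2_dot.
Variable R : realType.
Implicit Types x y z : ell2 R.
Local Notation dot := (@ell2_dot R).

Lemma cvg_ell2_dot x y : cvgn (series (fun n => x n * y n)).
Proof. exact: cvg_series_mul (valP x) (valP y). Qed.

Lemma ell2_dotC x y : dot x y = dot y x.
Proof. by congr (limn (series _)); apply/funext => n; rewrite mulrC. Qed.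

Lemma ell2_dot_linear y : linear_for *%R (dot ^~ y).
Proof.
move=> a x x'; rewrite /ell2_dot.
pose u n : R := x n * y n; pose v n : R := x' n * y n.
have cu : cvgn (series u) := @cvg_ell2_dot x y.
have cv : cvgn (series v) := @cvg_ell2_dot x' y.
rewrite (_ : (fun n => _) = a *: u + v); last first.
  by apply/funext => n; rewrite /u /v !fctE /GRing.scale /= mulrDl mulrA.
have cau : cvgn (series (a *: u)) by exact: is_cvg_seriesZ.
by rewrite (lim_seriesD cau cv) (lim_seriesZ _ cu).
Qed.

Fact ell2_dot_bilinear :
  bilinear_for ( *%R : GRing.Scale.law R R) ( *%R : GRing.Scale.law R R) dot.
Proof.
split=> [y|x]; first exact: ell2_dot_linear.
by move=> a y y' /=; rewrite !(ell2_dotC x) ell2_dot_linear.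
Qed.

Lemma sqr_le_ell2_dot x n : x n ^+ 2 <= dot x x.
Proof.
pose s := series (fun n => x n * x n).
have s_nd : nondecreasing_seq s.
  by apply/nondecreasing_seqP => m; rewrite /s /series /= big_nat_recr //=
    lerDl -expr2 sqr_ge0.
apply: le_trans (nondecreasing_cvgn_le s_nd (@cvg_ell2_dot x x) n.+1).
rewrite /s /series /= big_nat_recr //= expr2 lerDr sumr_ge0 // => i _.
by rewrite -expr2 sqr_ge0.
Qed.

Lemma ell2_dot_ge0 x : 0 <= dot x x.
Proof. exact: le_trans (sqr_ge0 (x 0%N)) (sqr_le_ell2_dot _ _). Qed.

Lemma ell2_dot_eq0 x : dot x x = 0 -> x = 0.
Proof.
move=> x0; apply/val_inj/funext => n /=; apply/eqP.
by rewrite -sqrf_eq0 eq_le sqr_ge0 andbT -x0 sqr_le_ell2_dot.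
Qed.

Fact ell2_dot_gt0 x : x != 0 -> 0 < dot x x.
Proof.
by move=> x0; rewrite lt_def ell2_dot_ge0 andbT; apply: contra_neq x0;
  exact: ell2_dot_eq0.
Qed.

Fact ell2_dot_hermitian x y : dot x y = (-1) ^+ false * idfun (dot y x).
Proof. by rewrite expr0 mul1r; exact: ell2_dotC. Qed.

End ell2_dot.

HB.instance Definition _ (R : realType) :=
  bilinear_isBilinear.Build R (ell2 R) (ell2 R) R *%R (idfun \; *%R)
    (@ell2_dot R) (@ell2_dot_bilinear R).
HB.instance Definition _ (R : realType) :=
  isHermitianSesquilinear.Build R (ell2 R) false idfun (@ell2_dot R)
    (@ell2_dot_hermitian R).
HB.instance Definition _ (R : realType) :=
  isDotProduct.Build R (ell2 R) (@ell2_dot R) (@ell2_dot_gt0 R).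

Section ell2_norm.
Variable R : realType.
Implicit Types x y : ell2 R.
Local Notation dot := (@ell2_dot R).

Definition ell2_norm x : R := Num.sqrt (dot x x).

Lemma ell2_normK x : ell2_norm x ^+ 2 = dot x x.
Proof. exact/sqr_sqrtr/ell2_dot_ge0. Qed.

Lemma ell2_CauchySchwarz x y : `|dot x y| <= ell2_norm x * ell2_norm y.
Proof.
have [->|y0] := eqVneq y 0.
  by rewrite linear0r normr0 mulr_ge0 ?sqrtr_ge0.
have y_gt0 := ell2_dot_gt0 y0.
rewrite -(@ler_pXn2r _ 2) ?nnegrE ?mulr_ge0 ?sqrtr_ge0 //.
rewrite exprMn !ell2_normK real_normK ?num_real //.
have := ell2_dot_ge0 (dot y y *: x - dot x y *: y).
rewrite linearBr !linearBl !linearZr !linearZl_LR /= !linearZr /=.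
rewrite (ell2_dotC y x) => h.
rewrite -subr_ge0 -(pmulr_rge0 _ y_gt0); apply: le_trans h _.
by rewrite le_eqVlt; apply/orP; left; apply/eqP; rewrite /GRing.scale /=; ring.
Qed.

Fact ler_ell2_normD x y : ell2_norm (x + y) <= ell2_norm x + ell2_norm y.
Proof.
rewrite -(@ler_pXn2r _ 2) ?nnegrE ?addr_ge0 ?sqrtr_ge0 //.
rewrite sqrrD !ell2_normK linearDr !linearDl /= (ell2_dotC y x).
have := le_trans (ler_norm _) (ell2_CauchySchwarz x y); lra.
Qed.

Fact ell2_normZ (a : R) x : ell2_norm (a *: x) = `|a| * ell2_norm x.
Proof.
rewrite /ell2_norm linearZr linearZl_LR /= mulrA -expr2.
by rewrite sqrtrM ?sqr_ge0 // sqrtr_sqr.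
Qed.

Fact ell2_norm_eq0 x : ell2_norm x = 0 -> x = 0.
Proof.
by move=> x0; apply: ell2_dot_eq0; rewrite -ell2_normK x0 expr0n.
Qed.

End ell2_norm.

HB.instance Definition _ (R : realType) := Lmodule_isNormed.Build R (ell2 R)
  (@ler_ell2_normD R) (@ell2_normZ R) (@ell2_norm_eq0 R).

(* The library norms products by the maximum of the norms of the components;  *)
(* this is equivalent to the Hilbert norm of the direct sum, hence gives the  *)
(* same topology and the same differentiable maps.                            *)
Definition heisenberg (R : realType) : normedModType R :=
  (ell2 R * ell2 R * R)%type.

Section heisenberg.
Variable R : realType.
Local Notation H := (heisenberg R).
Implicit Types p q r v w : H.

Definition hmul p q : H :=
  (p.1.1 + q.1.1, p.1.2 + q.1.2,
   p.2 + q.2 + ell2_dot p.1.1 q.1.2 - ell2_dot p.1.2 q.1.1).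

Lemma hmul0 p : hmul p 0 = p.
Proof.
case: p => [[x y] t].
by rewrite /hmul /= !linear0r !addr0 subr0.
Qed.

Lemma hmulN p : hmul p (- p) = 0.
Proof.
case: p => [[x y] t]; rewrite /hmul /= !linearNr /= (ell2_dotC y x).
by rewrite !subrr sub0r opprK addNr.
Qed.

Lemma hmulA p q r : hmul p (hmul q r) = hmul (hmul p q) r.
Proof.
case: p q r => [[x y] t] [[x' y'] t'] [[x'' y''] t''].
rewrite /hmul /= !addrA !linearDr !linearDl /=; congr (_, _, _); ring.
Qed.

Definition dhmul p v : H :=
  (v.1.1, v.1.2, v.2 + ell2_dot p.1.1 v.1.2 - ell2_dot p.1.2 v.1.1).

Fact dhmul_linear p : linear (dhmul p).
Proof.
move=> a [[x y] t] [[x' y'] t']; rewrite /dhmul /= !linearDr !linearZr /=.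
by congr (_, _, _); rewrite -?[RHS]/(a * _ + _) /GRing.scale /=; ring.
Qed.

HB.instance Definition _ p :=
  GRing.isLinear.Build R H H *:%R (dhmul p) (dhmul_linear p).

Lemma continuous_ell2_dot (x : ell2 R) : continuous (ell2_dot x).
Proof.
have x_gt0 : 0 < 1 + ell2_norm x by rewrite ltr_pwDl ?sqrtr_ge0.
move=> y; apply/(@cvgrPdist_lt _ R _ (nbhs y)) => e e0; near=> z.
rewrite -linearBr; apply: le_lt_trans (ell2_CauchySchwarz x _) _.
apply: (@le_lt_trans _ _ ((1 + ell2_norm x) * ell2_norm (y - z))).
  by rewrite ler_wpM2r ?sqrtr_ge0 // lerDr.
rewrite -ltr_pdivlMl // -[ell2_norm _]/(`|y - z|).
near: z; apply: cvgr_dist_lt; first exact: cvg_id.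
by rewrite mulr_gt0 ?invr_gt0.
Unshelve. all: by end_near. Qed.

Fact continuous_dhmul p : continuous (dhmul p).
Proof.
have c1 : continuous (fun v : H => v.1) by move=> v; exact: cvg_fst.
have c11 : continuous (fun v : H => v.1.1).
  by move=> v; apply: (@cvg_comp _ _ _ _ fst _ _ _ (c1 v)); exact: cvg_fst.
have c12 : continuous (fun v : H => v.1.2).
  by move=> v; apply: (@cvg_comp _ _ _ _ snd _ _ _ (c1 v)); exact: cvg_snd.
have cd (x : ell2 R) (f : H -> ell2 R) : continuous f ->
    continuous (fun v => ell2_dot x (f v)).
  move=> cf v; apply: (@cvg_comp _ _ _ f (ell2_dot x) _ _ _ (cf v)).
  exact: continuous_ell2_dot.
have cp (V W : normedModType R) (f : H -> V) (g : H -> W) :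
    continuous f -> continuous g -> continuous (fun v => (f v, g v)).
  by move=> cf cg v; apply: cvg_pair; [exact: cf|exact: cg].
apply: (cp (ell2 R * ell2 R)%type R); first exact: cp.
move=> v; apply: (@cvgB _ R); last exact: cd.
by apply: (@cvgD _ R); [exact: cvg_snd|exact: cd].
Qed.

Lemma diff_hmul p r v : 'd (hmul p) r v = dhmul p v.
Proof.
have -> : hmul p = cst p + dhmul p.
  apply/funext => q; rewrite fctE; case: p q => [[x y] t] [[x' y'] t'].
  by congr (_, _, _) => /=; rewrite -!addrA.
have cp := @continuous_dhmul p.
have dp : differentiable (dhmul p) r by exact: linear_differentiable.
have e1 := congr1 (@^~ v) (diffD (@differentiable_cst R H H p r) dp).
have e2 : 'd (cst p : H -> H) r v = 0 := congr1 (@^~ v) (diff_cst p r).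
have e3 : 'd (dhmul p) r v = dhmul p v := congr1 (@^~ v) (diff_lin r cp).
apply: etrans e1 _; apply: etrans (congr2 +%R e2 e3) _; exact: add0r.
Qed.

(* {dot H for idfun} is the type of symmetric positive definite bilinear      *)
(* forms on H. The scalar product sigma0 at the identity is transported to    *)
(* the tangent space at p by the left multiplication by p^-1 = - p; it need   *)
(* not induce the topology of H.                                              *)
Definition left_invariant_weak_metric (sigma : H -> H -> H -> R) : Prop :=
  exists2 sigma0 : {dot H for idfun},
    continuous (fun vw : H * H => sigma0 vw.1 vw.2) &
    forall p v w,
      sigma p v w = sigma0 ('d (hmul (- p)) p v) ('d (hmul (- p)) p w).

Definition smooth (g : R -> H) : Prop :=
  forall n (t : R), derivable g^`(n)%classic t 1.

(* Smoothness on a closed interval is smoothness up to the end points, i.e.,  *)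
(* extendability to a smooth map on the line.                                 *)
Definition smooth_on (a b : R) (gamma : R -> H) : Prop :=
  exists2 g, smooth g & {in `[a, b], gamma =1 g}.

(* Only the values of gamma on [0, 1] matter.                                 *)
Definition piecewise_smooth (gamma : R -> H) : Prop :=
  {within `[0, 1], continuous gamma} /\
  exists2 s : seq R, itv_partition 0 1 s &
    forall i, (i < size s)%N ->
      smooth_on (nth 0 (0 :: s) i) (nth 0 s i) gamma.

(* At the points of the partition, 0 and 1 included, the derivative need not  *)
(* exist or may depend on values outside [0, 1]; these form a null set.       *)
Definition curve_length (sigma : H -> H -> H -> R) (gamma : R -> H) : \bar R :=
  \int[lebesgue_measure]_(t in `[0, 1])
    (Num.sqrt (sigma (gamma t) (gamma^`()%classic t) (gamma^`()%classic t)))%:E.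

Definition geodesic_distance (sigma : H -> H -> H -> R) p q : \bar R :=
  ereal_inf [set curve_length sigma gamma | gamma in
    [set gamma | [/\ piecewise_smooth gamma, gamma 0 = p & gamma 1 = q]]].

End heisenberg.

(* Main.v *)
(* Take sigma_0(v, w) = <T v_1, T w_1> + <T v_2, T w_2> + v_3 w_3, where T is  *)
(* the injective diagonal operator e_n |-> e_n / (n + 1). In the n-th copy of  *)
(* the three dimensional Heisenberg group, a unit circle lifts to a horizontal *)
(* curve, which joins 0 to (0, 0, 2 pi), whatever n is. As the curve is        *)
(* horizontal, its length only involves T e_n: it is 2 pi / (n + 1), and the   *)
(* distance between the two end points is 0.                                   *)
Require Import Defs.
From HB Require Import structures.
From mathcomp Require Import all_boot all_order all_algebra.
From mathcomp Require Import sesquilinear ring lra.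
From mathcomp Require Import all_classical all_reals all_analysis.
Set Implicit Arguments.
Unset Strict Implicit.
Unset Printing Implicit Defensive.
Import Order.TTheory GRing.Theory Num.Theory.
Import numFieldNormedType.Exports.
Local Open Scope ring_scope.
Local Open Scope classical_set_scope.

(** The vertical displacement of a horizontal curve is twice the area swept by its planar
    projection. That area is measured by the undamped scalar product of the group law, whereas the
    length of the curve is measured through the damping T. A weak metric may let the first stay
    fixed while the second tends to 0. Injectivity of T makes [damped_dot] definite and boundedness
    of T makes it continuous ([left_invariant_damped_metric]). The circles all enclose area pi
    ([circle_lift1]), are horizontal ([circle_lift_horizontal]), and have lengths tending to 0
    ([curve_length_circle_lift]). *)

(** * Orthonormal vectors of the sequence space *)

Section unit_vector.
Context {R : realType}.

Definition unit_seq (n : nat) : nat -> R := fun k => (k == n)%:R.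

(** Partial sums are constant beyond rank n. Taking for [x] the sequence itself gives square
    summability. *)
Lemma cvg_series_unit_seq n (x : nat -> R) :
  series (fun k => unit_seq n k * x k) @ \oo --> x n.
Proof.
apply: cvg_near_cst; near=> m.
have nm : (n < m)%N by near: m; exact: nbhs_infty_gt.
rewrite /series /= big_mkord (bigD1 (Ordinal nm)) //= /unit_seq eqxx mul1r.
rewrite big1 ?addr0 // => i; rewrite -val_eqE /= => /negbTE ->.
by rewrite mul0r.
Unshelve. all: by end_near. Qed.

Fact unit_seq_square_summable n : unit_seq n \in @square_summable R.
Proof.
apply/square_summableP.
rewrite (_ : (fun _ => _) = (fun k => unit_seq n k * unit_seq n k)).
  by apply/cvg_ex; exists (unit_seq n n); exact: cvg_series_unit_seq.
by apply/funext => k; rewrite expr2.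
Qed.

Definition unit_vector n : ell2 R := Ell2 (unit_seq_square_summable n).

Lemma ell2_dot_unit_vector n x : ell2_dot (unit_vector n) x = x n.
Proof. exact/cvg_lim/cvg_series_unit_seq. Qed.

End unit_vector.

(** * The damping operator T and continuity of the scalar product *)

Section damping.
Context {R : realType}.
Implicit Types x y : ell2 R.

Lemma harmonic_sqr_le1 n : (harmonic n : R) ^+ 2 <= 1.
Proof. by rewrite expr_le1 // ?harmonic_ge0 // invf_le1 ?ltr0n // ler1n. Qed.

Lemma damp_sqr_le x n : (harmonic n * x n) ^+ 2 <= x n ^+ 2.
Proof. by rewrite exprMn ler_piMl ?sqr_ge0 ?harmonic_sqr_le1. Qed.

Fact damp_square_summable x :
  (fun n => harmonic n * x n) \in @square_summable R.
Proof.
apply/square_summableP.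
apply: (@series_le_cvg R _ (fun n => x n ^+ 2)) => [n|n|n|].
- exact: sqr_ge0.
- exact: sqr_ge0.
- exact: damp_sqr_le.
- exact/square_summableP/valP.
Qed.

Definition damp x : ell2 R := Ell2 (damp_square_summable x).

Fact damp_linear : linear damp.
Proof.
move=> a x y; apply/val_inj/funext => n.
by rewrite /= !fctE /GRing.scale /=; ring.
Qed.

HB.instance Definition _ :=
  GRing.isLinear.Build R (ell2 R) (ell2 R) *:%R damp damp_linear.

Lemma damp_eq0 x : damp x = 0 -> x = 0.
Proof.
move=> /(congr1 val) /= dx; apply/val_inj/funext => n.
have /eqP := congr1 (@^~ n) dx; rewrite /= mulf_eq0 => /orP[|/eqP->//].
by rewrite gt_eqF // harmonic_gt0.
Qed.

(** Termwise comparison, as the diagonal entries 1/(n+1) of T are at most 1; being linear, T is then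
    continuous. *)
Lemma ell2_norm_damp x : `|damp x| <= `|x|.
Proof.
apply: ler_wsqrtr; apply: ler_lim; [exact: cvg_ell2_dot|exact: cvg_ell2_dot|].
by apply: nearW => m; apply: ler_sum => i _; rewrite -!expr2 damp_sqr_le.
Qed.

Lemma continuous_damp : continuous damp.
Proof.
move=> x; apply/(@cvgrPdist_lt _ _ _ (nbhs x)) => e e0; near=> z.
rewrite -linearB; apply: le_lt_trans (ell2_norm_damp _) _.
by near: z; apply: cvgr_dist_lt; [exact: cvg_id|].
Unshelve. all: by end_near. Qed.

Lemma damp_unit_vector n : damp (unit_vector n) = harmonic n *: unit_vector n.
Proof.
apply/val_inj/funext => k /=; rewrite fctE /= /unit_seq /GRing.scale /=.
by have [->//|] := eqVneq k n; rewrite !mulr0.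
Qed.

Lemma ell2_dot_damp_unit_vector n :
  ell2_dot (damp (unit_vector n)) (damp (unit_vector n)) = harmonic n ^+ 2.
Proof.
rewrite damp_unit_vector linearZr linearZl_LR /= ell2_dot_unit_vector /=.
by rewrite /unit_seq eqxx mulr1 -expr2.
Qed.

(** Polarization reduces joint continuity of the scalar product to continuity of the norm. *)
Lemma ell2_dot_polar x y : ell2_dot x y = (`|x + y| ^+ 2 - `|x - y| ^+ 2) / 4.
Proof.
rewrite -[`|x + y|]/(ell2_norm _) -[`|x - y|]/(ell2_norm _) !ell2_normK.
rewrite linearDr linearBr !linearDl !linearNl /= (ell2_dotC y x).
by move: (ell2_dot x x) (ell2_dot y y) (ell2_dot x y) => a b c; lra.
Qed.

Lemma cvg_ell2_dot_pair {T : Type} {F : set_system T} {FF : Filter F}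
    (f g : T -> ell2 R) x y :
  f @ F --> x -> g @ F --> y ->
  (fun t => ell2_dot (f t) (g t)) @ F --> ell2_dot x y.
Proof.
move=> fx gy; under eq_fun do rewrite ell2_dot_polar.
rewrite ell2_dot_polar; apply: cvgM; last exact: cvg_cst.
apply: cvgB; rewrite /= expr2; under eq_fun do rewrite expr2.
  by apply: cvgM; apply: cvg_norm; exact: cvgD.
by apply: cvgM; apply: cvg_norm; exact: cvgB.
Qed.

End damping.

(** * The weak scalar product at the identity *)

Section damped_dot.
Context {R : realType}.
Local Notation H := (heisenberg R).

Definition damped_dot (v w : H) : R :=
  ell2_dot (damp v.1.1) (damp w.1.1) + ell2_dot (damp v.1.2) (damp w.1.2)
  + v.2 * w.2.

Lemma damped_dotC v w : damped_dot v w = damped_dot w v.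
Proof.
by rewrite /damped_dot mulrC [X in X + _ + _]ell2_dotC [X in _ + X + _]ell2_dotC.
Qed.

Lemma damped_dot_linear w : linear_for *%R (damped_dot ^~ w).
Proof.
move=> a [[x y] t] [[x' y'] t']; rewrite /damped_dot /= !linearP /=.
rewrite !linearDl !linearZl_LR /= /GRing.scale /=; ring.
Qed.

Fact damped_dot_bilinear :
  bilinear_for ( *%R : GRing.Scale.law R R) ( *%R : GRing.Scale.law R R)
    damped_dot.
Proof.
split=> [w|v]; first exact: damped_dot_linear.
by move=> a w w' /=; rewrite !(damped_dotC v) damped_dot_linear.
Qed.

Fact damped_dot_hermitian v w :
  damped_dot v w = (-1) ^+ false * idfun (damped_dot w v).
Proof. by rewrite expr0 mul1r; exact: damped_dotC. Qed.

Fact damped_dot_gt0 v : v != 0 -> 0 < damped_dot v v.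
Proof.
have d0 (x : ell2 R) : 0 <= ell2_dot (damp x) (damp x) := ell2_dot_ge0 _.
move=> v0; have dge0 : 0 <= damped_dot v v.
  by rewrite !addr_ge0 // -expr2 sqr_ge0.
rewrite lt_def dge0 andbT; apply: contra_neq v0.
case: v {dge0} => [[x y] t]; rewrite /damped_dot /= => /eqP.
rewrite paddr_eq0 ?addr_ge0 -?expr2 ?sqr_ge0 // paddr_eq0 // sqrf_eq0.
by move=> /andP[/andP[/eqP/ell2_dot_eq0/damp_eq0-> /eqP/ell2_dot_eq0/damp_eq0->]
  /eqP->].
Qed.

HB.instance Definition _ :=
  bilinear_isBilinear.Build R H H R *%R (idfun \; *%R)
    damped_dot damped_dot_bilinear.
HB.instance Definition _ :=
  isHermitianSesquilinear.Build R H false idfun damped_dot damped_dot_hermitian.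
HB.instance Definition _ := isDotProduct.Build R H damped_dot damped_dot_gt0.

Lemma continuous_damped_dot :
  continuous (fun vw : H * H => damped_dot vw.1 vw.2).
Proof.
have c1 : continuous (fun v : H => damp v.1.1).
  move=> v; apply: continuous_cvg; first exact: continuous_damp.
  exact: (@cvg_comp _ _ _ fst fst _ _ _ cvg_fst cvg_fst).
have c2 : continuous (fun v : H => damp v.1.2).
  move=> v; apply: continuous_cvg; first exact: continuous_damp.
  exact: (@cvg_comp _ _ _ fst snd _ _ _ cvg_fst cvg_snd).
move=> [v w]; apply: cvgD; first apply: cvgD.
- apply: cvg_ell2_dot_pair.
    by apply: (@cvg_comp _ _ _ fst (fun u : H => damp u.1.1) _ (nbhs v)); [exact: cvg_fst|exact: c1].
  by apply: (@cvg_comp _ _ _ snd (fun u : H => damp u.1.1) _ (nbhs w)); [exact: cvg_snd|exact: c1].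
- apply: cvg_ell2_dot_pair.
    by apply: (@cvg_comp _ _ _ fst (fun u : H => damp u.1.2) _ (nbhs v)); [exact: cvg_fst|exact: c2].
  by apply: (@cvg_comp _ _ _ snd (fun u : H => damp u.1.2) _ (nbhs w)); [exact: cvg_snd|exact: c2].
- apply: cvgM.
    exact: (@cvg_comp _ _ _ fst snd _ _ _ cvg_fst cvg_snd).
  exact: (@cvg_comp _ _ _ snd snd _ _ _ cvg_snd cvg_snd).
Qed.

End damped_dot.

(** * Smoothness of trigonometric curves *)

Section trigonometric_curve.
Context {R : realType} {V : normedModType R}.
Implicit Types (A B C D : V) (w t : R).

(** This family is closed under differentiation, which only changes the coefficients; the affine
    part accommodates the vertical drift of the lifted circles. *)
Definition trig_curve w A B C D t : V :=
  cos (w * t) *: A + sin (w * t) *: B + t *: C + D.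

Lemma is_derive_scalel (f : R -> R) (df t : R) A :
  is_derive t 1 f df -> is_derive t 1 (fun s => f s *: A) (df *: A).
Proof.
move=> [df1 df2].
have ff : differentiable f t by exact/derivable1_diffP.
split; first exact/derivable1_diffP/differentiableZl.
rewrite deriveE; last exact: differentiableZl.
by rewrite diffZl //= -deriveE // df2.
Qed.

Lemma is_derive_trig_curve w A B C D t :
  is_derive t 1 (trig_curve w A B C D)
    (trig_curve w (w *: B) (- w *: A) 0 C t).
Proof.
have dw : is_derive t 1 ( *%R w) w.
  have := is_deriveZ w (is_derive_id t 1); rewrite /GRing.scale /= mulr1.
  exact.
have dc : is_derive t 1 (fun s => cos (w * s)) (- sin (w * t) * w).
  exact: (is_derive1_comp (f := cos)).
have ds : is_derive t 1 (fun s => sin (w * s)) (cos (w * t) * w).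
  exact: (is_derive1_comp (f := sin)).
have hA := is_derive_scalel A dc.
have hB := is_derive_scalel B ds.
have hC := is_derive_scalel C (is_derive_id t 1).
have := is_deriveD (is_deriveD (is_deriveD hA hB) hC) (is_derive_cst D t 1).
rewrite [X in is_derive _ _ _ X](_ : _ = trig_curve w (w *: B) (- w *: A) 0 C t)//.
rewrite /trig_curve !scalerA scaler0 !addr0 scale1r; congr (_ + _).
by rewrite addrC mulNr mulrN mulrC [w * _]mulrC.
Qed.

Lemma derive1_trig_curve w A B C D :
  (trig_curve w A B C D)^`() = trig_curve w (w *: B) (- w *: A) 0 C.
Proof.
apply/funext => t; rewrite derive1E; apply: derive_val.
exact: is_derive_trig_curve.
Qed.

Lemma derivable_derive1n_trig_curve w A B C D n t :
  derivable (trig_curve w A B C D)^`(n) t 1.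
Proof.
(* The coefficients are generalized because differentiating once replaces them. *)
elim: n A B C D => [|n IHn] A B C D.
  exact: (@ex_derive _ _ _ _ _ _ _ (is_derive_trig_curve w A B C D t)).
by rewrite derive1Sn derive1_trig_curve.
Qed.

Lemma continuous_trig_curve w A B C D : continuous (trig_curve w A B C D).
Proof.
move=> t; apply/differentiable_continuous/derivable1_diffP.
exact: (@ex_derive _ _ _ _ _ _ _ (is_derive_trig_curve w A B C D t)).
Qed.

End trigonometric_curve.

(** * Lifted circles of vanishing length *)

Section vertical_collapse.
Context {R : realType}.
Local Notation H := (heisenberg R).

Definition damped_metric (p v w : H) : R :=
  damped_dot (dhmul (- p) v) (dhmul (- p) w).

Lemma left_invariant_damped_metric : left_invariant_weak_metric damped_metric.
Proof.
exists damped_dot; first exact: continuous_damped_dot.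
by move=> p v w; rewrite /damped_metric !diff_hmul.
Qed.

Definition vertical_point : H := (0, 0, pi *+ 2).

Lemma cos2pi : cos (pi *+ 2) = 1 :> R.
Proof. by rewrite cos_mulr2n cospi sqrrN expr1n mulr2n addrK. Qed.

Lemma sin2pi : sin (pi *+ 2) = 0 :> R.
Proof. by rewrite sin_mulr2n sinpi mulr0 mul0rn. Qed.

(* The horizontal lift, starting at the identity, of the unit circle centred
   at - e_n in the plane spanned by the n-th vectors e_n of both factors. *)
Definition circle_lift n : R -> H :=
  let e := unit_vector n in
  trig_curve (pi *+ 2) ((e, 0, 0) : H) ((0, e, -1) : H) ((0, 0, pi *+ 2) : H)
    ((- e, 0, 0) : H).

Lemma circle_liftE n t : let e := unit_vector n in let s := pi *+ 2 * t in
  circle_lift n t = ((cos s - 1) *: e, sin s *: e, s - sin s).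
Proof.
rewrite /circle_lift /trig_curve /=; congr (_, _, _).
- by rewrite /= !scaler0 !addr0 scalerBl scale1r.
- by rewrite /= !scaler0 !addr0 add0r.
- by rewrite /= /GRing.scale /=; ring.
Qed.

Lemma circle_lift_derive n t : let e := unit_vector n in let w := pi *+ 2 in
  (circle_lift n)^`() t =
  ((- w * sin (w * t)) *: e, (w * cos (w * t)) *: e, w - w * cos (w * t)).
Proof.
rewrite /= derive1_trig_curve /trig_curve; congr (_, _, _).
- by rewrite /= !scaler0 !addr0 add0r scalerA mulrC.
- by rewrite /= !scaler0 !addr0 scalerA mulrC.
- by rewrite /= /GRing.scale /=; ring.
Qed.

Lemma circle_lift_horizontal n t : let w := pi *+ 2 in
  dhmul (- circle_lift n t) ((circle_lift n)^`() t) =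
  ((- w * sin (w * t)) *: unit_vector n, (w * cos (w * t)) *: unit_vector n, 0).
Proof.
rewrite /= circle_lift_derive circle_liftE /dhmul /=; congr (_, _, _).
rewrite !linearNl /= !linearZr !linearZl_LR /= !ell2_dot_unit_vector /=.
rewrite /unit_seq eqxx /= /GRing.scale /= !mulr1.
have := cos2Dsin2 (pi *+ 2 * t); move: (cos _) (sin _) => c s cs.
(* The vertical speed cancels against the rate of area, by Pythagoras. *)
rewrite (_ : _ + _ = pi *+ 2 * (1 - (c ^+ 2 + s ^+ 2))); last ring.
by rewrite cs subrr mulr0.
Qed.

(** Only the two horizontal components remain; each carries the factor 1/(n+1) from T, and
    Pythagoras removes the dependence on [t]. *)
Lemma circle_lift_speed n t :
  damped_metric (circle_lift n t) ((circle_lift n)^`() t)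
    ((circle_lift n)^`() t) = (pi *+ 2 * harmonic n) ^+ 2.
Proof.
rewrite /damped_metric circle_lift_horizontal /damped_dot /=.
rewrite !linearZ /= !linearZr !linearZl_LR /= !ell2_dot_damp_unit_vector.
have := cos2Dsin2 (pi *+ 2 * t); move: (cos _) (sin _) => c s cs.
rewrite mulr0 addr0 /GRing.scale /=; set h := _^-1.
transitivity ((pi *+ 2 * h) ^+ 2 * (c ^+ 2 + s ^+ 2)); first by ring.
by rewrite cs mulr1.
Qed.

Lemma curve_length_circle_lift n :
  curve_length damped_metric (circle_lift n) = (pi *+ 2 * harmonic n)%:E.
Proof.
have h0 : 0 <= pi *+ 2 * harmonic n :> R.
  by rewrite mulr_ge0 ?harmonic_ge0 // mulrn_wge0 // pi_ge0.
rewrite /curve_length.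
under eq_integral do rewrite circle_lift_speed sqrtr_sqr ger0_norm //.
rewrite integral_cst; last exact: measurable_itv.
have I1 : lebesgue_measure `[0%R : R, 1%R] = 1%E.
  by rewrite lebesgue_measure_itv /= lte_fin ltr01 oppr0 adde0.
by apply: etrans (congr1 _ I1) _; rewrite mule1.
Qed.

Lemma piecewise_smooth_circle_lift n : piecewise_smooth (circle_lift n).
Proof.
split.
  exact/continuous_subspaceT/continuous_trig_curve.
(* The curve is smooth on the whole line, so a single piece suffices. *)
exists [:: 1]; first by split=> //=; rewrite ltr01.
case=> // _; exists (circle_lift n) => // k t.
exact: derivable_derive1n_trig_curve.
Qed.

Lemma circle_lift0 n : circle_lift n 0 = 0.
Proof. by rewrite circle_liftE mulr0 cos0 sin0 !subrr !scale0r. Qed.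

Lemma circle_lift1 n : circle_lift n 1 = vertical_point.
Proof. by rewrite circle_liftE mulr1 cos2pi sin2pi subrr !scale0r subr0. Qed.

Lemma geodesic_distance_vertical_point :
  geodesic_distance damped_metric 0 vertical_point = 0%E.
Proof.
apply/eqP; rewrite eq_le; apply/andP; split.
  have cl : (fun n => (pi *+ 2 * harmonic n)%:E) @ \oo --> (0 : R)%:E.
    apply: cvg_EFin; first exact: nearW.
    rewrite -(mulr0 (pi *+ 2)); apply: cvgM; [exact: cvg_cst|exact: cvg_harmonic].
  (* The distance is at most the length of every lifted circle, hence at most their limit 0. *)
  apply: (cvge_to_ge cl); apply: nearW => n.
  rewrite -curve_length_circle_lift; apply: ereal_inf_lbound.
  exists (circle_lift n) => //; split; last exact: circle_lift1.
    exact: piecewise_smooth_circle_lift.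
  exact: circle_lift0.
apply: le_ereal_inf_tmp => _ [gamma _ <-].
by apply: integral_ge0 => t _; rewrite lee_fin sqrtr_ge0.
Qed.

End vertical_collapse.

Theorem theorem1p1 (R : realType) :
  exists sigma : heisenberg R -> heisenberg R -> heisenberg R -> R,
    left_invariant_weak_metric sigma /\
    exists p q : heisenberg R, p <> q /\ geodesic_distance sigma p q = 0%E.
Proof.
exists damped_metric; split; first exact: left_invariant_damped_metric.
exists 0, vertical_point; split; last exact: geodesic_distance_vertical_point.
by move=> /(congr1 snd) /= /eqP; rewrite eq_sym mulrn_eq0 /= gt_eqF ?pi_gt0.
Qed.
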